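(* Let $K$ and $L$ be simplicial complexes with nonempty vertex sets. If the join $K\ast L$ is a simplicial $3$-sphere, then $K\ast L$ has the toric lifting property; that is, every mod $2$ characteristic map over $K\ast L$ admits a lift.
   Context: $\mathbb Z_2=\mathbb Z/2\mathbb Z$. Simplicial complexes are abstract simplicial complexes, and each element of the vertex set is a vertex (its singleton is a simplex). The join of simplicial complexes $K_1,K_2$ on vertex sets $V_1,V_2$ is the simplicial complex $K_1\ast K_2=\{\tau_1\cup\tau_2\mid \tau_1\in K_1,\ \tau_2\in K_2\}$ on $V_1\sqcup V_2$ (the empty simplex is included in each complex). A simplicial $3$-sphere is a simplicial complex whose geometric realization is homeomorphic to $S^3$. Facets are maximal simplices. For a simplicial $3$-sphere $M$ with vertex set $V(M)$, a mod $2$ characteristic map over $M$ is a map $\lambda^{\mathbb R}\colon V(M)\to\mathbb Z_2^4$ such that the images of the four vertices of every facet form a basis of $\mathbb Z_2^4$. An integral characteristic map over $M$ is a map $\lambda\colon V(M)\to\mathbb Z^4$ such that the images of the four vertices of every facet form a basis of $\mathbb Z^4$. A lift of $\lambda^{\mathbb R}$ is an integral characteristic map $\lambda$ over $M$ with $\lambda(v)\equiv\lambda^{\mathbb R}(v)\pmod 2$ for every vertex $v$. $M$ has the toric lifting property if every mod $2$ characteristic map over $M$ admits a lift. *)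

(* Defs.v *)
From HB Require Import structures.
From mathcomp Require Import all_boot all_order all_algebra.
From mathcomp Require Import finmap.
From mathcomp Require Import all_classical all_reals all_analysis.
Import numFieldNormedType.Exports.
Import GRing.Theory Num.Theory.

Set Implicit Arguments.
Unset Strict Implicit.
Unset Printing Implicit Defensive.

Local Open Scope classical_set_scope.
Local Open Scope ring_scope.

(* The vertex set is the whole type [V]; it may be infinite. *)
Record complex (V : choiceType) := Complex {
  faces :> {fset V} -> Prop ;
  faces0 : faces fset0 ;
  faces1 : forall v, faces [fset v]%fset ;
  faces_sub : forall s t, faces t -> (s `<=` t)%fset -> faces s
}.

Definition facet (V : choiceType) (K : complex V) (s : {fset V}) :=
  K s /\ forall t, K t -> (s `<=` t)%fset -> t = s.

Section Join.
Variables (V W : choiceType) (K : complex V) (L : complex W).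

Definition join_faces : set {fset (V + W)%type} :=
  [set s | exists s1 s2, [/\ K s1, L s2 &
     s = ((@inl V W) @` s1 `|` (@inr V W) @` s2)%fset]].

Lemma join_faces0 : join_faces fset0.
Proof.
by exists fset0, fset0; split; rewrite ?imfset0 ?fsetU0 //; apply: faces0.
Qed.

Lemma join_faces1 v : join_faces [fset v]%fset.
Proof.
case: v => v.
  exists [fset v]%fset, fset0; split; [exact: faces1|exact: faces0|].
  by rewrite imfset0 fsetU0 imfset_fset1.
exists fset0, [fset v]%fset; split; [exact: faces0|exact: faces1|].
by rewrite imfset0 fset0U imfset_fset1.
Qed.

Lemma join_faces_sub s t : join_faces t -> (s `<=` t)%fset -> join_faces s.
Proof.
move=> [t1 [t2 [Kt1 Lt2 ->]]] /fsubsetP st.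
exists [fset v in t1 | inl v \in s]%fset, [fset w in t2 | inr w \in s]%fset.
split.
- by apply: faces_sub Kt1 _; apply/fsubsetP => v; rewrite !inE => /andP[].
- by apply: faces_sub Lt2 _; apply/fsubsetP => w; rewrite !inE => /andP[].
apply/fsetP => x; rewrite in_fsetU; apply/idP/orP.
  move=> xs; have := st _ xs; rewrite in_fsetU => /orP[]/imfsetP[v /= vt xE].
    by left; apply/imfsetP; exists v => //=; rewrite !inE -xE xs vt.
  by right; apply/imfsetP; exists v => //=; rewrite !inE -xE xs vt.
by case=> /imfsetP[v /=]; rewrite !inE => /andP[_ ?] ->.
Qed.

Definition join : complex (V + W)%type :=
  Complex join_faces0 join_faces1 join_faces_sub.

End Join.

Section Realization.
Variables (R : realType) (V : choiceType) (K : complex V).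

Definition closed_simplex (s : {fset V}) : set {ptws V -> R} :=
  [set x | [/\ forall v, 0 <= x v, forall v, v \notin s -> x v = 0 &
               \sum_(v <- s) x v = 1]].

Definition realization : Type :=
  set_type (\bigcup_(s in [set s | K s]) closed_simplex s).

HB.instance Definition _ := Choice.on realization.

(* The coherent topology: a set is open iff its trace on each closed simplex
   is relatively open there. On a closed simplex, the pointwise topology is
   the Euclidean one, as only finitely many coordinates are nonzero. *)
Definition realization_open : set_system realization :=
  [set U | forall s, K s -> exists2 O : set {ptws V -> R}, open O &
     forall x : realization, closed_simplex s (val x) -> U x <-> O (val x)].

Lemma realization_openT : realization_open setT.
Proof. by move=> s _; exists setT => //; exact: openT. Qed.

Lemma realization_openI : setI_closed realization_open.
Proof.
move=> U1 U2 oU1 oU2 s Ks.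
have [B1 oB1 e1] := oU1 s Ks; have [B2 oB2 e2] := oU2 s Ks.
exists (B1 `&` B2); first exact: openI.
by move=> x sx; split=> -[] /(e1 _ sx) ? /(e2 _ sx).
Qed.

Lemma realization_open_bigU (I : Type) (f : I -> set realization) :
  (forall i, realization_open (f i)) -> realization_open (\bigcup_i f i).
Proof.
move=> of_ s Ks; pose O i := cid2 (of_ i s Ks).
exists (\bigcup_i s2val (O i)).
  by apply: bigcup_open => i _; exact: (s2valP (O i)).
by move=> x sx; split=> -[i _] /(s2valP' (O i) x sx) fx; exists i.
Qed.

HB.instance Definition _ := isOpenTopological.Build realization
  realization_openT realization_openI realization_open_bigU.

End Realization.

Definition homeomorphic (X Y : topologicalType) :=
  exists (f : X -> Y) (g : Y -> X),
    [/\ cancel f g, cancel g f, continuous f & continuous g].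

Definition unit_sphere (R : realType) (n : nat) : set 'rV[R]_n.+1 :=
  [set x | \sum_i x ord0 i ^+ 2 = 1].

Definition simplicial_sphere (R : realType) (n : nat) (V : choiceType)
    (K : complex V) :=
  homeomorphic (realization R K) (set_type (@unit_sphere R n)).

(* Over a nonzero commutative ring this forces [#|I| = n]. *)
Definition is_basis (A : comNzRingType) (n : nat) (I : finType)
    (b : I -> 'rV[A]_n) :=
  forall x : 'rV[A]_n, exists! c : {ffun I -> A}, x = \sum_i c i *: b i.

Definition characteristic_map (A : comNzRingType) (V : choiceType)
    (M : complex V) (lam : V -> 'rV[A]_4) :=
  forall s : {fset V}, facet M s -> is_basis (fun v : s => lam (val v)).

Definition is_lift (V : choiceType) (M : complex V)
    (lamR : V -> 'rV['F_2]_4) (lam : V -> 'rV[int]_4) :=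
  characteristic_map M lam /\
  forall v, map_mx (fun z : int => z%:~R) (lam v) = lamR v.

Definition toric_lifting_property (V : choiceType) (M : complex V) :=
  forall lamR : V -> 'rV['F_2]_4, characteristic_map M lamR ->
    exists lam : V -> 'rV[int]_4, is_lift M lamR lam.

(* Main.v *)
Require Import Defs.
From mathcomp Require Import all_classical all_reals all_analysis.
From mathcomp Require Import all_boot all_order all_algebra.
From mathcomp Require Import mxabelem finmap ring.

Set Implicit Arguments.
Unset Strict Implicit.
Unset Printing Implicit Defensive.
Import Order.TTheory GRing.Theory Num.Theory.
Local Open Scope ring_scope.

(** A facet of [join K L] is the union of a facet of [K] and a facet of [L].
    Since it has four vertices, all facets of [K] have one size p and all facets
    of [L] the size 4 - p, where p is 1, 2 or 3. What remains is linear algebra: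
    given a family of p-tuples and a family of (4 - p)-tuples of vectors of
    F_2^4, such that every concatenation is a basis, find one section [ell] of
    the reduction Z^4 -> F_2^4 that turns all these bases into bases of Z^4.

    The sections used here come from a basis of F_2^4. It lifts to a basis of
    Z^4 ([unimodular_lift]), and [ell] sends a vector to the integral vector
    whose coordinates in the lifted basis are the same zeros and ones. A 0/1
    matrix with odd determinant is unimodular in size 3, but in size 4 the
    determinant may be 3 or -3. It is unimodular as soon as some row, the
    difference of two rows, or some column has a single nonzero entry, equal
    to 1 or -1, because expanding there leaves a minor of size 3. So the basis
    has to be such that every facet has this form in its coordinates
    ([adapted_lift]).

    Such a basis exists because one of the two families is small. The exterior
    products of the tuples give a set A in the p-th exterior power and a set B
    in the (4 - p)-th, which is its dual, and all pairings between A and B equal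
    1. If the affine spans of A and B have dimensions k and l, then k + l is
    less than the dimension of the exterior power ([card_dual_affine]).

    For p = 2 that dimension is 6, so one of the two families spans at most
    2^2 = 4 planes of F_2^4, that is, lines of the projective space. Four lines
    can always be hit by linearly independent points ([hit_four]), and a basis
    containing these points is adapted to all facets ([lift_pairs]).

    For p = 1 the dimension is 4, so A or B has at most two elements. Two
    distinct nonzero vectors over F_2 are independent; if A is small its
    elements are taken as basis vectors, and if B is small its elements, the
    equations of the hyperplanes spanned by the triples, are taken as
    coordinates ([lift_point_triples]). The case p = 3 is the case p = 1 with
    the two families exchanged. *)

(** * Determinants of 0/1 matrices *)

Definition rows (A : nzRingType) (n : nat) (r : seq 'rV[A]_n) : 'M[A]_n :=
  \matrix_(i < n) r`_i.

Lemma det_first_row (A : comNzRingType) (n : nat) (g : nat -> nat -> A) :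
  \det (\matrix_(i < n.+1, j < n.+1) g i j) =
  \sum_(k < n.+1) g 0%N k * ((-1) ^+ k *
    \det (\matrix_(i < n, j < n) g i.+1 (bump k j))).
Proof.
rewrite (expand_det_row _ ord0); apply: eq_bigr => k _.
rewrite mxE /cofactor add0n; congr (_ * (_ * \det _)).
by apply/matrixP=> i j; rewrite !mxE.
Qed.

Lemma det_3 (A : comNzRingType) (g : nat -> nat -> A) :
  \det (\matrix_(i < 3, j < 3) g i j) =
    g 0 0 * (g 1 1 * g 2 2 - g 1 2 * g 2 1)
  - g 0 1 * (g 1 0 * g 2 2 - g 1 2 * g 2 0)
  + g 0 2 * (g 1 0 * g 2 1 - g 1 1 * g 2 0).
Proof.
rewrite (det_first_row 2 g) !big_ord_recl big_ord0.
pose h k i j := g i.+1 (bump k j).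
rewrite !(det_first_row 1 (h _)) !big_ord_recl !big_ord0 !det_mx11 !mxE.
by rewrite /h /bump /=; ring.
Qed.

(** The Laplace expansion along the first two rows. *)
Lemma det_4 (A : comNzRingType) (g : nat -> nat -> A) :
  let m i j k l := g i k * g j l - g i l * g j k in
  \det (\matrix_(i < 4, j < 4) g i j) =
    m 0 1 0 1 * m 2 3 2 3 - m 0 1 0 2 * m 2 3 1 3 + m 0 1 0 3 * m 2 3 1 2
  + m 0 1 1 2 * m 2 3 0 3 - m 0 1 1 3 * m 2 3 0 2 + m 0 1 2 3 * m 2 3 0 1.
Proof.
move=> m; rewrite (det_first_row 3 g) !big_ord_recl big_ord0.
pose h k i j := g i.+1 (bump k j).
rewrite !(det_3 (h _)) /m /h /bump /=; ring.
Qed.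

(** Three of the six terms of the determinant count positively and three
    negatively. A value of 3 would need the three terms of one sign, hence all
    nine entries, to be 1, but then the determinant is 0; so an odd value is 1
    or -1. The proof runs through the 512 matrices. *)
Lemma odd_det01_3 (g : nat -> nat -> bool) :
  let D := \det (\matrix_(i < 3, j < 3) (g i j)%:R : 'M[int]_3) in
  (D%:~R : 'F_2) != 0 -> D \is a GRing.unit.
Proof.
rewrite /= (det_3 (fun i j => (g i j)%:R)).
by move: (g 0 0)%N (g 0 1)%N (g 0 2)%N (g 1 0)%N (g 1 1)%N (g 1 2)%N
  (g 2 0)%N (g 2 1)%N (g 2 2)%N; do 9!case.
Qed.

Definition lift01 (x : 'F_2) : int := (x : nat)%:Z.

Definition mod2 (n : nat) (x : 'rV[int]_n) : 'rV['F_2]_n :=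
  map_mx (fun z : int => z%:~R) x.

Lemma F2_cases (x : 'F_2) : x = 0 \/ x = 1.
Proof. by case: x => [[|[|m]] //= lm]; [left | right]; apply: val_inj. Qed.

Lemma F2_neq0 (x : 'F_2) : x != 0 -> x = 1.
Proof. by case: (F2_cases x) => -> //; rewrite eqxx. Qed.

Lemma F2_addxx (V : lmodType 'F_2) (x : V) : x + x = 0.
Proof.
by rewrite -mulr2n -scaler_nat (_ : 2%:R = 0) ?scale0r //; apply: val_inj.
Qed.

Lemma F2_opp (x : 'F_2) : - x = x.
Proof. by case: (F2_cases x) => ->; apply: val_inj. Qed.

Lemma lift01K (x : 'F_2) : (lift01 x)%:~R = x.
Proof. by case: (F2_cases x) => ->; apply: val_inj. Qed.

Lemma lift01_mxK (m n : nat) (N : 'M['F_2]_(m, n)) :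
  map_mx intr (map_mx lift01 N) = N.
Proof. by apply/matrixP=> i j; rewrite !mxE lift01K. Qed.

Lemma lift01_unit3 (N : 'M['F_2]_3) :
  N \in unitmx -> map_mx lift01 N \in unitmx.
Proof.
pose g i j := N (inord i) (inord j) == 1.
have -> : map_mx lift01 N = \matrix_(i < 3, j < 3) (g i j)%:R.
  apply/matrixP=> i j; rewrite !mxE /g !inord_val.
  by case: (F2_cases (N i j)) => ->.
have NE : N = map_mx intr (\matrix_(i < 3, j < 3) (g i j)%:R : 'M[int]_3).
  apply/matrixP=> i j; rewrite !mxE /g !inord_val.
  by case: (F2_cases (N i j)) => ->; apply: val_inj.
by rewrite [in N \in _]NE !unitmxE det_map_mx unitfE => /odd_det01_3.
Qed.

(** The expansion along row [i] consists of one minor of size 3, over both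
    rings. *)
Lemma lift01_unit_row (N : 'M['F_2]_4) (i j : 'I_4) :
  N \in unitmx -> row i N = delta_mx 0 j -> map_mx lift01 N \in unitmx.
Proof.
move=> uN iN.
have Nij k : N i k = (k == j)%:R.
  by have := congr1 (fun x : 'rV_4 => x 0 k) iN; rewrite !mxE eqxx.
have expand (A : comNzRingType) (N' : 'M[A]_4) :
    (forall k, N' i k = (k == j)%:R) -> \det N' = cofactor N' i j.
  move=> N'i; rewrite (expand_det_row _ i) (bigD1 j) //= N'i eqxx mul1r.
  by rewrite big1 ?addr0 // => k /negPf kj; rewrite N'i kj mul0r.
move: uN; rewrite !unitmxE !expand //; last first.
  by move=> k; rewrite mxE Nij; case: (k == j).
rewrite /cofactor -map_col' -map_row' !unitrMr ?unitrX ?unitrN1 //.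
by rewrite -!unitmxE; apply: lift01_unit3.
Qed.

Lemma lift01_unit_col (N : 'M['F_2]_4) (i j : 'I_4) :
  N \in unitmx -> col j N = delta_mx i 0 -> map_mx lift01 N \in unitmx.
Proof.
move=> uN jN; rewrite -unitmx_tr map_trmx.
apply: (@lift01_unit_row _ j i); first by rewrite unitmx_tr.
by rewrite -tr_col jN trmx_delta.
Qed.

(** The integral lifts of rows [i] and [i'] differ by plus or minus the [j]-th
    unit vector, so replacing row [i] by that unit vector changes the
    determinant at most by a sign. *)
Lemma lift01_unit_row2 (N : 'M['F_2]_4) (i i' j : 'I_4) :
  N \in unitmx -> i != i' -> row i N + row i' N = delta_mx 0 j ->
  map_mx lift01 N \in unitmx.
Proof.
move=> uN ii' sN.
pose repl (A : comNzRingType) (N' : 'M[A]_4) (x : 'rV_4) : 'M[A]_4 :=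
  \matrix_k (if k == i then x else row k N').
have repli A N' x : row i (@repl A N' x) = x by rewrite rowK eqxx.
have repl' A N' x : row' i (@repl A N' x) = row' i N'.
  apply/row_matrixP=> k; apply/rowP=> l; rewrite !mxE.
  by rewrite eq_sym (negPf (neq_lift _ _)) mxE.
have alt A N' : \det (@repl A N' (row i' N')) = 0.
  apply: (determinant_alternate ii') => k.
  by rewrite !mxE eqxx eq_sym (negPf ii') !mxE.
pose N1 := repl _ N (delta_mx 0 j).
have detN : \det N = \det N1.
  rewrite (@determinant_multilinear _ _ N N1 (repl _ N (row i' N)) i 1 1).
  - by rewrite alt !mul1r addr0.
  - by rewrite !repli !scale1r -sN -addrA F2_addxx addr0.
  - by rewrite repl'.
  - by rewrite repl'.
have uN1 : map_mx lift01 N1 \in unitmx.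
  by apply: (@lift01_unit_row _ i j); [| exact: repli];
    rewrite unitmxE -detN -unitmxE.
have N1E : map_mx lift01 N1 = repl _ (map_mx lift01 N) (delta_mx 0 j).
  apply/matrixP=> k l; rewrite mxE [N1 k l]mxE [RHS]mxE.
  by case: (k == i); rewrite !mxE //; case: (_ && _).
have Nij k : N i k + N i' k = (k == j)%:R.
  by have := congr1 (fun x : 'rV_4 => x 0 k) sN; rewrite !mxE eqxx.
(* [e] is 1 or -1, depending on which of the two rows has a 1 in column [j]. *)
pose e : int := lift01 (N i j) - lift01 (N i' j).
have ue : e \is a GRing.unit.
  move: (Nij j); rewrite eqxx /e.
  by case: (F2_cases (N i j)) => ->; case: (F2_cases (N i' j)) => ->.
rewrite unitmxE (@determinant_multilinear _ _ _ (map_mx lift01 N1)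
  (repl _ (map_mx lift01 N) (row i' (map_mx lift01 N))) i e 1).
- by rewrite alt mulr0 addr0 unitrMr // -unitmxE.
- rewrite N1E !repli scale1r; apply/rowP=> k; rewrite !mxE eqxx /=.
  have := Nij k; case: eqP => [->|_] /=; first by rewrite mulr1 /e subrK.
  rewrite mulr0 add0r.
  by case: (F2_cases (N i k)) => ->; case: (F2_cases (N i' k)) => ->.
- by rewrite N1E repl'.
- by rewrite repl'.
Qed.

(** * Lifting a basis *)

(** Smith form over the integers: the diagonal entries are odd, so dropping
    the diagonal factor does not change the matrix modulo 2. *)
Lemma unimodular_lift (n : nat) (M : 'M['F_2]_n) :
  M \in unitmx -> exists2 B : 'M[int]_n, B \in unitmx & map_mx intr B = M.
Proof.
move=> uM.
have [L uL [Q uQ [d _ dE]]] := int_Smith_normal_form (map_mx lift01 M).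
exists (L *m Q); first by rewrite unitmx_mul uL.
pose D : 'rV['F_2]_n := \row_i (d`_i)%:~R.
have ME : M = map_mx intr L *m diag_mx D *m map_mx intr Q.
  rewrite -[LHS]lift01_mxK dE !map_mxM; congr (_ *m _ *m _).
  by apply/matrixP=> i j; rewrite !mxE -val_eqE; case: (_ == _).
suff D1 : D = const_mx 1 by rewrite map_mxM [RHS]ME D1 diag_const_mx mulmx1.
have : diag_mx D \in unitmx.
  by move: uM; rewrite ME !unitmx_mul => /andP[/andP[]].
rewrite unitmxE unitfE det_diag => /prodf_neq0 D1.
by apply/rowP=> i; rewrite [RHS]mxE; apply: F2_neq0; apply: D1.
Qed.

Lemma row_invmx (F : fieldType) n (M : 'M[F]_n) i :
  M \in unitmx -> row i M *m invmx M = delta_mx 0 i.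
Proof. by move=> uM; rewrite -row_mul mulmxV // row1. Qed.

Lemma row_unit_neq0 (F : fieldType) n (M : 'M[F]_n) i :
  M \in unitmx -> row i M != 0.
Proof.
move=> uM; apply/eqP=> i0; have := row_invmx i uM; rewrite i0 mul0mx.
by move/rowP/(_ i); rewrite !mxE !eqxx => /esym/eqP; rewrite oner_eq0.
Qed.

(** The second alternative is needed for a facet containing [u] and [v] when
    the basis contains [u + v] instead of [u] or [v]. *)
Definition adapted (N : 'M['F_2]_4) :=
  [\/ exists i j, row i N = delta_mx 0 j,
      exists i i' j, i != i' /\ row i N + row i' N = delta_mx 0 j |
      exists i j, col j N = delta_mx i 0].

(** Modulo the unimodular factor [B] lifting [M], the lifted matrix is the 0/1
    lift of the matrix of coordinates in the basis [M]. *)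
Lemma adapted_lift (M : 'M['F_2]_4) : M \in unitmx ->
  exists ell : 'rV['F_2]_4 -> 'rV[int]_4, (forall v, mod2 (ell v) = v) /\
    forall r, rows r \in unitmx -> adapted (rows r *m invmx M) ->
      rows (map ell r) \in unitmx.
Proof.
move=> uM; have [B uB BM] := unimodular_lift uM.
pose ell (v : 'rV_4) := map_mx lift01 (v *m invmx M) *m B.
exists ell; split=> [v|r ur ad].
  by rewrite /mod2 /ell map_mxM lift01_mxK BM mulmxKV.
(* If [r] is shorter than 4, the missing entries of [r] and of [map ell r]
   are both read as 0. *)
have ell0 : ell 0 = 0.
  rewrite /ell mul0mx (_ : map_mx _ _ = 0) ?mul0mx //.
  by apply/rowP=> j; rewrite !mxE.
have -> : rows (map ell r) = map_mx lift01 (rows r *m invmx M) *m B.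
  apply/row_matrixP=> i; rewrite rowK row_mul -map_row row_mul rowK.
  have [ir|ri] := ltnP i (size r); first by rewrite (nth_map 0).
  by rewrite !nth_default ?size_map // -/(ell 0) ell0.
rewrite unitmx_mul uB andbT.
have uN : rows r *m invmx M \in unitmx by rewrite unitmx_mul ur unitmx_inv.
case: ad => [[i [j e]]|[i [i' [j [ii' e]]]]|[i [j e]]].
- exact: lift01_unit_row e.
- exact: lift01_unit_row2 ii' e.
- exact: lift01_unit_col e.
Qed.

(** * Families of vectors with all pairings equal to 1 *)

(** Let U and W be the spans of the differences of elements of [A] and of [B].
    Then U is orthogonal to [b0] and W to [a0], and U and W are orthogonal to
    each other. As [a0] pairs to 1 with [b0], it is not in U; so U + <a0> has
    dimension dim U + 1 and is orthogonal to W, whence dim U + 1 + dim W <= n.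
    Finally [A] lies in a0 + U and [B] in b0 + W. *)
Lemma card_dual_affine (F : finFieldType) (n : nat) (A B : {set 'rV[F]_n})
    (a0 b0 : 'rV[F]_n) : a0 \in A -> b0 \in B ->
  {in A & B, forall a b : 'rV[F]_n, a *m b^T = 1%:M} ->
  exists k l, [/\ (k + l < n)%N, (#|A| <= #|F| ^ k)%N & (#|B| <= #|F| ^ l)%N].
Proof.
move=> Aa0 Bb0 AB.
pose diffs (C : {set 'rV[F]_n}) c0 : 'M[F]_(#|C|, n) :=
  \matrix_i (enum_val i - c0).
have le_card (C : {set 'rV[F]_n}) c0 : (#|C| <= #|F| ^ \rank (diffs C c0))%N.
  rewrite -card_rowg -[leqLHS](card_imset _ (addIr (- c0))).
  apply: subset_leq_card.
  apply/subsetP=> _ /imsetP[c Cc ->]; rewrite mem_rowg.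
  suff -> : c - c0 = row (enum_rank_in Cc c) (diffs C c0) by apply: row_sub.
  by rewrite rowK enum_rankK_in.
exists (\rank (diffs A a0)), (\rank (diffs B b0)); split=> //.
have Ab b : b \in B -> diffs A a0 *m b^T = 0.
  move=> Bb; apply/row_matrixP=> i; rewrite row_mul rowK row0 mulmxBl.
  by rewrite !AB ?enum_valP // subrr.
have AB0 : col_mx (diffs A a0) a0 *m (diffs B b0)^T = 0.
  rewrite mul_col_mx.
  have B0 m (X : 'M[F]_(m, n)) :
      (forall b, b \in B -> X *m b^T = X *m b0^T) -> X *m (diffs B b0)^T = 0.
    move=> XB; apply/trmx_inj; rewrite trmx_mul trmxK trmx0.
    apply/row_matrixP=> i; rewrite row_mul rowK row0 mulmxBl.
    apply/trmx_inj; rewrite raddfB /= !trmx_mul !trmxK trmx0 XB ?subrr //.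
    exact: enum_valP.
  by rewrite !B0 ?col_mx0 // => b Bb; rewrite ?AB // !Ab.
have := mulmx0_rank_max AB0; rewrite mxrank_tr.
apply: leq_trans; rewrite -addSn leq_add2r.
suff: (diffs A a0 < col_mx (diffs A a0) a0)%MS by rewrite ltmxErank => /andP[].
rewrite ltmxE -addsmxE addsmxSl /= col_mx_sub submx_refl /=.
apply/negP=> /submxP[D a0E].
have /matrixP/(_ 0 0) := AB _ _ Aa0 Bb0.
by rewrite a0E -mulmxA Ab // mulmx0 !mxE eqxx => /esym/eqP; rewrite oner_eq0.
Qed.

(** * Independent points on lines *)

Lemma rows_unit_free (F : fieldType) (n : nat) (r : seq 'rV[F]_n) :
  size r = n -> (rows r \in unitmx) = free r.
Proof.
move=> /eqP sr; rewrite unitmxE unitfE.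
apply/idP/idP => [/det0P inj|/(@freeP _ _ _ (Tuple sr)) fr].
  apply/(@freeP _ _ _ (Tuple sr)) => k k0 i; apply/eqP; apply: contraT => ki.
  case: inj; exists (\row_i k i).
    by apply: contra_neq ki => /rowP/(_ i); rewrite !mxE.
  by rewrite mulmx_sum_row -[RHS]k0; apply: eq_bigr => j _; rewrite mxE rowK.
apply/det0P => -[v v0 vr]; case/negP: v0; apply/eqP/rowP=> i; rewrite mxE.
apply: (fr (fun i => v 0 i)); rewrite -[RHS]vr mulmx_sum_row.
by apply: eq_bigr => j _; rewrite rowK.
Qed.

Lemma dim_rV (F : fieldType) n : \dim {:'rV[F]_n} = n.
Proof. by rewrite dimvf /dim /= mul1n. Qed.

Lemma free_complete (F : fieldType) (n : nat) (X : seq 'rV[F]_n) : free X ->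
  exists2 Y, size (X ++ Y) = n & rows (X ++ Y) \in unitmx.
Proof.
move=> fX; have sXY : size (X ++ vbasis (<<X>>^C)%VS) = n.
  rewrite size_cat size_tuple dimv_compl (eqnP fX) dim_rV.
  by rewrite subnKC // -(eqnP fX) -[leqRHS](dim_rV F) dimvS ?subvf.
exists (vbasis (<<X>>^C)%VS) => //; rewrite rows_unit_free // cat_free fX.
rewrite (basis_free (vbasisP _)) (span_basis (vbasisP _)).
by apply/directv_addP; rewrite capv_compl.
Qed.

Lemma free_row (F : fieldType) (n : nat) (X : seq 'rV[F]_n) : free X ->
  exists2 M : 'M[F]_n, M \in unitmx &
    forall x, x \in X -> exists i, row i M = x.
Proof.
move=> /free_complete[Y sXY uXY]; exists (rows (X ++ Y)) => // x xX.
have xXY : x \in X ++ Y by rewrite mem_cat xX.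
have lt : (index x (X ++ Y) < n)%N by rewrite -[ltnRHS]sXY index_mem.
by exists (Ordinal lt); rewrite rowK nth_index.
Qed.

Definition hits (K : fieldType) (vT : vectType K) (X : seq vT)
  (P : {vspace vT}) := has [in P] X.

Section Transversal.
Variables (K : fieldType) (vT : vectType K).
Implicit Types (X : seq vT) (P : {vspace vT}).

Lemma extend_free X P : free X -> (size X < \dim P)%N ->
  exists2 x, x \in P & free (x :: X).
Proof.
move=> fX; rewrite -(eqnP fX) => lt; have /subvPn[x xP xX] : ~~ (P <= <<X>>)%VS.
  by apply: contraL lt => /dimvS; rewrite -leqNgt.
by exists x => //; rewrite free_cons xX.
Qed.

(** If [P] were contained in [<<X>>], it would be equal to it for reasons of
    dimension, and [a] would lie in [P]. *)
Lemma extend_free_off X P a :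
  free X -> (size X <= \dim P)%N -> a \in X -> a \notin P ->
  exists2 x, x \in P & free (x :: X).
Proof.
move=> fX sX aX aP; have /subvPn[x xP xX] : ~~ (P <= <<X>>)%VS.
  apply: contra aP => PX; suff /eqP -> : P == <<X>>%VS by apply: memv_span.
  by rewrite eqEdim PX (eqnP fX).
by exists x => //; rewrite free_cons xX.
Qed.

Lemma hit_one_more X P a : free X -> (size X <= \dim P)%N -> a \in X ->
  exists X', [/\ free X', (size X' <= (size X).+1)%N, {subset X <= X'} &
    hits X' P].
Proof.
move=> fX sX aX; have [aP|aP] := boolP (a \in P).
  by exists X; split=> //; apply/hasP; exists a.
have [x xP fxX] := extend_free_off fX sX aX aP.
exists (x :: X); split=> //; last by rewrite /hits /= xP.
by move=> y yX; rewrite inE yX orbT.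
Qed.

Lemma hits_sub X X' P : {subset X <= X'} -> hits X P -> hits X' P.
Proof.
by move=> XX' /hasP[x xX xP]; apply/hasP; exists x => //; apply: XX'.
Qed.

(** In projective terms the spaces of dimension 2 are lines and the nonzero
    vectors are points. A common point [a] of [P1] and [P2] hits two of the
    lines. Each of the other two either contains [a] as well or, by
    [extend_free_off], has a point that is independent of the points chosen
    before, which are at most two and include [a]. *)
Lemma hit_four_meeting P1 P2 P3 P4 :
  \dim P3 = 2 -> \dim P4 = 2 -> (P1 :&: P2 != 0)%VS ->
  exists2 X, free X & [/\ hits X P1, hits X P2, hits X P3 & hits X P4].
Proof.
move=> d3 d4; rewrite -vpick0; set a := vpick _ => a0.
have /andP[aP1 aP2] : (a \in P1) && (a \in P2) by rewrite -memv_cap memv_pick.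
have fa : free [:: a] by rewrite free_cons span_nil memv0 a0 nil_free.
have [X [fX sX aX X3]] : exists X, [/\ free X, (size X <= 2)%N,
    {subset [:: a] <= X} & hits X P3].
  by apply: hit_one_more fa _ (mem_head _ _); rewrite d3.
have [X' [fX' _ XX' X4]] : exists X', [/\ free X', (size X' <= (size X).+1)%N,
    {subset X <= X'} & hits X' P4].
  by apply: (hit_one_more fX _ (aX _ (mem_head _ _))); rewrite d4.
have aX' : a \in X' by apply/XX'/aX/mem_head.
by exists X' => //; split=> //; [apply/hasP; exists a.. | apply: hits_sub X3].
Qed.

(** Points [a] of [P1] and [b] of [P2] span a line different from [P3] and
    [P4], both of which avoid [a]. As [P3] and [P4] together span the whole
    space, they are not both contained in one hyperplane through [a] and [b], so
    points of [P3] and of [P4] can be chosen that stay independent modulo [a]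
    and [b]. *)
Lemma hit_four_skew P1 P2 P3 P4 :
  \dim {:vT} = 4 ->
  \dim P1 = 2 -> \dim P2 = 2 -> \dim P3 = 2 -> \dim P4 = 2 ->
  (P1 :&: P3 = 0)%VS -> (P1 :&: P4 = 0)%VS -> (P3 :&: P4 = 0)%VS ->
  exists2 X, free X & [/\ hits X P1, hits X P2, hits X P3 & hits X P4].
Proof.
move=> d d1 d2 d3 d4 P13 P14 P34.
have [a aP1 fa] : exists2 x, x \in P1 & free [:: x].
  by apply: extend_free; rewrite ?nil_free ?d1.
have a0 : a != 0 by move: fa; rewrite free_cons span_nil memv0 => /andP[].
have [b bP2 fb] : exists2 x, x \in P2 & free [:: x; a].
  by apply: extend_free; rewrite ?d2.
have off P : (P1 :&: P = 0)%VS -> a \notin P.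
  by move=> PP; apply: contra a0 => aP; rewrite -memv0 -PP memv_cap aP1.
have [c cP3 fc] : exists2 x, x \in P3 & free [:: x; b; a].
  by apply: (@extend_free_off _ _ a) => //; rewrite ?d3 ?off // !inE eqxx orbT.
have [x xP4 fx] : exists2 x, x \in P4 & free [:: x; b; a].
  by apply: (@extend_free_off _ _ a) => //; rewrite ?d4 ?off // !inE eqxx orbT.
(* If [P3] leaves the hyperplane spanned by [x], [b] and [a], a point of [P3]
   outside works together with [x]; otherwise [c] spans the same hyperplane
   with [b] and [a], and [P4] must leave it. *)
have [] := boolP (P3 <= <<[:: x; b; a]>>)%VS; last first.
  case/subvPn=> r r3 rX; exists [:: r; x; b; a]; first by rewrite free_cons rX.
  by rewrite /hits /= aP1 bP2 r3 xP4 ?orbT.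
move=> P3X.
have cX : <<[:: c; b; a]>>%VS = <<[:: x; b; a]>>%VS.
  apply/eqP; rewrite eqEdim (eqnP fc) (eqnP fx) leqnn andbT.
  apply/span_subvP => y; rewrite !inE => /or3P[] /eqP ->.
  - exact: (subvP P3X).
  - by rewrite memv_span // !inE eqxx orbT.
  - by rewrite memv_span // !inE eqxx !orbT.
have /subvPn[s s4 sX] : ~~ (P4 <= <<[:: c; b; a]>>)%VS.
  apply: contraTN isT => P4X.
  have : (P3 + P4 <= <<[:: x; b; a]>>)%VS by rewrite subv_add P3X -cX.
  by move/dimvS; rewrite (eqnP fx) dimv_disjoint_sum // d3 d4.
have fsc : free [:: s; c; b; a] by rewrite free_cons sX.
exists [:: s; c; b; a] => //.
by rewrite /hits /= aP1 bP2 cP3 s4 ?orbT.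
Qed.

Lemma hit_four P1 P2 P3 P4 :
  \dim {:vT} = 4 ->
  \dim P1 = 2 -> \dim P2 = 2 -> \dim P3 = 2 -> \dim P4 = 2 ->
  exists2 X, free X & [/\ hits X P1, hits X P2, hits X P3 & hits X P4].
Proof.
move=> d d1 d2 d3 d4.
have [P12|n12] := eqVneq (P1 :&: P2)%VS 0%VS; last exact: hit_four_meeting.
have [P13|n13] := eqVneq (P1 :&: P3)%VS 0%VS; last first.
  by have [X fX [? ? ? ?]] := hit_four_meeting d2 d4 n13; exists X.
have [P14|n14] := eqVneq (P1 :&: P4)%VS 0%VS; last first.
  by have [X fX [? ? ? ?]] := hit_four_meeting d2 d3 n14; exists X.
have [P34|n34] := eqVneq (P3 :&: P4)%VS 0%VS; last first.
  by have [X fX [? ? ? ?]] := hit_four_meeting d1 d2 n34; exists X.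
exact: hit_four_skew.
Qed.

End Transversal.

(** * Families of pairs of vectors *)

Lemma F2_span2 (V : vectType 'F_2) (u v x : V) :
  x \in <<[:: u; v]>>%VS -> x != 0 -> [\/ x = u, x = v | x = u + v].
Proof.
rewrite span_cons span_seq1 => /memv_addP[_ /vlineP[k ->] [_ /vlineP[l ->] ->]].
by case: (F2_cases k) => ->; case: (F2_cases l) => ->;
   rewrite ?scale0r ?scale1r ?add0r ?addr0 ?eqxx; constructor.
Qed.

(** Over F_2 the [i]-th basis vector is one of the two entries or their sum. *)
Lemma adapted_hit (M : 'M['F_2]_4) (r : seq 'rV['F_2]_4) (i i1 i2 : 'I_4) :
  M \in unitmx -> i1 != i2 -> row i M \in <<[:: r`_i1; r`_i2]>>%VS ->
  adapted (rows r *m invmx M).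
Proof.
move=> uM i12 /F2_span2/(_ (row_unit_neq0 _ uM)) h.
have e := row_invmx i uM.
case: h => h; rewrite h in e.
- by apply: Or31; exists i1, i; rewrite row_mul rowK.
- by apply: Or31; exists i2, i; rewrite row_mul rowK.
- by apply: Or32; exists i1, i2, i; rewrite !row_mul !rowK -mulmxDl.
Qed.

Definition simultaneous_lift (S T : seq 'rV['F_2]_4 -> Prop) :=
  exists ell : 'rV['F_2]_4 -> 'rV[int]_4, (forall v, mod2 (ell v) = v) /\
    forall X Y, S X -> T Y -> rows (map ell (X ++ Y)) \in unitmx.

(** The coordinates of the exterior product of the two entries of [X], ordered
    so that [rev_ord] exchanges complementary pairs of indices. *)
Definition pluecker (X : seq 'rV['F_2]_4) : 'rV['F_2]_6 :=
  let m i j := X`_0 0 (inord i) * X`_1 0 (inord j)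
             - X`_0 0 (inord j) * X`_1 0 (inord i) in
  \row_k [:: m 0 1; m 0 2; m 0 3; m 1 2; m 1 3; m 2 3]`_k.

Definition pluecker_dual X : 'rV['F_2]_6 := \row_k pluecker X 0 (rev_ord k).

(** This is the Laplace expansion along the first two rows; its signs vanish
    modulo 2. *)
Lemma det_pluecker (X Y : seq 'rV['F_2]_4) : size X = 2 -> size Y = 2 ->
  \det (rows (X ++ Y)) = (pluecker X *m (pluecker_dual Y)^T) 0 0.
Proof.
case: X Y => [|u [|v []]] // [|x [|y []]] // _ _.
pose g i j := ([:: u; v; x; y]`_i : 'rV_4) 0 (inord j).
have -> : rows ([:: u; v] ++ [:: x; y]) = \matrix_(i < 4, j < 4) g i j.
  by apply/matrixP=> k l; rewrite !mxE /g inord_val.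
rewrite det_4 mxE !big_ord_recl big_ord0 !mxE /g /=.
rewrite !F2_opp; ring.
Qed.

Lemma det_swap_pairs (X Y : seq 'rV['F_2]_4) : size X = 2 -> size Y = 2 ->
  \det (rows (X ++ Y)) = \det (rows (Y ++ X)).
Proof.
case: X Y => [|u [|v []]] // [|x [|y []]] // _ _.
pose g (r : seq 'rV['F_2]_4) i j := (r`_i : 'rV_4) 0 (inord j).
have E r : rows r = \matrix_(i < 4, j < 4) g r i j.
  by apply/matrixP=> k l; rewrite !mxE /g inord_val.
by rewrite !E !det_4 /g /=; ring.
Qed.

Lemma rows_repeat (r : seq 'rV['F_2]_4) (i j : 'I_4) :
  i != j -> r`_i = r`_j -> \det (rows r) = 0.
Proof.
by move=> ij e; apply: (determinant_alternate ij) => k; rewrite !mxE e.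
Qed.

(** An element [y] of [Y] outside [<<X>>] could be completed with [X] to a
    basis; but replacing [X] by [Y] does not change the determinant, and then
    the row [y] is repeated. *)
Lemma span_eq_det (X Y : seq 'rV['F_2]_4) :
  size X = 2 -> size Y = 2 -> free X -> free Y ->
  (forall Z, size Z = 2 -> \det (rows (X ++ Z)) = \det (rows (Y ++ Z))) ->
  <<X>>%VS = <<Y>>%VS.
Proof.
move=> sX sY fX fY XY; apply/esym/eqP.
rewrite eqEdim (eqnP fX) (eqnP fY) sX sY leqnn andbT.
apply/span_subvP=> y yY; apply: contraT => yX.
have fXy : free (rcons X y).
  by rewrite (@perm_free _ _ _ (y :: X)) ?perm_rcons // free_cons yX.
have [Z] := free_complete fXy.
rewrite cat_rcons size_cat sX => /(@addnI 2 _ 2) sZ.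
rewrite unitmxE unitfE XY // => /negP[]; apply/eqP.
have iy : (index y Y < 2)%N by rewrite -[ltnRHS]sY index_mem.
apply: (@rows_repeat _ (inord (index y Y)) (inord 2)).
  by rewrite -val_eqE /= !inordK ?(ltn_trans iy) // ltn_eqF.
rewrite !inordK ?(ltn_trans iy) // !nth_cat sY iy /=; exact: nth_index.
Qed.

(** Here [f] is an invariant that determines the plane spanned by a pair, such
    as its Pluecker vector, so at most four planes have to be hit. *)
Lemma hit_few_lines (C : finType) (f : seq 'rV['F_2]_4 -> C)
    (S : seq 'rV['F_2]_4 -> Prop) :
  (exists X, S X) -> (forall X, S X -> size X = 2 /\ free X) ->
  (forall X Y, S X -> S Y -> f X = f Y -> <<X>>%VS = <<Y>>%VS) ->
  (#|[set c | `[< exists2 X, S X & f X = c >]]| <= 4)%N ->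
  exists2 M : 'M['F_2]_4, M \in unitmx &
    forall X, S X -> exists i, row i M \in <<X>>%VS.
Proof.
move=> [X0 SX0] S2 fS; set A := [set c | _] => A4.
have [g gP] : exists g, forall c, c \in A -> S (g c) /\ f (g c) = c.
  suff /choice[g gP] : forall c, exists X, c \in A -> S X /\ f X = c.
    by exists g.
  move=> c.
  have [|_] := boolP (c \in A); last by exists X0.
  by rewrite inE => /asboolP[X SX fX]; exists X.
have fA X : S X -> f X \in A by move=> SX; rewrite inE; apply/asboolP; exists X.
(* For [i] beyond the number of invariants the line of [X0] is repeated. *)
pose line i := (<<g (nth (f X0) (enum A) i)>>)%VS.
have dline i : \dim (line i) = 2.
  have /gP[/S2[<- /eqnP //]] : nth (f X0) (enum A) i \in A.
  have [iA|Ai] := ltnP i (size (enum A)); last by rewrite nth_default // fA.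
  by rewrite -mem_enum mem_nth.
have [X fX [h0 h1 h2 h3]] :=
  hit_four (dim_rV _ 4) (dline 0) (dline 1) (dline 2) (dline 3).
have [M uM XM] := free_row fX; exists M => // Y SY.
have fYA := fA _ SY; have [SgY fgY] := gP _ fYA.
have lineY : line (index (f Y) (enum A)) = <<Y>>%VS.
  by rewrite /line nth_index ?mem_enum //; apply: fS.
have hY : hits X <<Y>>%VS.
  have : (index (f Y) (enum A) < 4)%N.
    by apply: leq_trans A4; rewrite cardE index_mem mem_enum.
  by rewrite -lineY; case: index => [|[|[|[|k]]]].
by have /hasP[x /XM[i <-] xY] := hY; exists i.
Qed.

(** The pairings of Pluecker vectors are determinants, hence equal to 1, so by
    [card_dual_affine] in dimension 6 one of the two families spans at most four
    planes. A basis hitting these planes is adapted to every facet. *)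
Lemma lift_pairs (S T : seq 'rV['F_2]_4 -> Prop) :
  (exists X, S X) -> (exists Y, T Y) ->
  (forall X, S X -> size X = 2) -> (forall Y, T Y -> size Y = 2) ->
  (forall X Y, S X -> T Y -> rows (X ++ Y) \in unitmx) ->
  simultaneous_lift S T.
Proof.
move=> exS exT S2 T2 ST; have [X0 SX0] := exS; have [Y0 TY0] := exT.
have freeXY X Y : S X -> T Y -> free (X ++ Y).
  by move=> SX TY; rewrite -rows_unit_free ?ST // size_cat S2 ?T2.
have freeS X : S X -> free X by move=> SX; apply: catl_free (freeXY _ _ SX TY0).
have freeT Y : T Y -> free Y by move=> TY; apply: catr_free (freeXY _ _ SX0 TY).
pose A := [set a | `[< exists2 X, S X & pluecker X = a >]].
pose B := [set b | `[< exists2 Y, T Y & pluecker_dual Y = b >]].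
have AX0 : pluecker X0 \in A by rewrite inE; apply/asboolP; exists X0.
have BY0 : pluecker_dual Y0 \in B by rewrite inE; apply/asboolP; exists Y0.
have dual : {in A & B, forall a b : 'rV_6, a *m b^T = 1%:M}.
  move=> a b; rewrite !inE => /asboolP[X SX <-] /asboolP[Y TY <-].
  rewrite [LHS]mx11_scalar -(det_pluecker (S2 _ SX) (T2 _ TY)).
  congr scalar_mx; apply: F2_neq0.
  by rewrite -unitfE -unitmxE; apply: ST.
have [k [l [kl Ak Bl]]] := card_dual_affine AX0 BY0 dual.
have {Ak Bl kl} : (#|A| <= 4)%N \/ (#|B| <= 4)%N.
  rewrite card_Fp // in Ak Bl.
  have [k3|k3] := ltnP k 3;
    [left; apply: leq_trans Ak _ | right; apply: leq_trans Bl _].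
    by rewrite (@leq_exp2l 2 k 2).
  rewrite (@leq_exp2l 2 l 2) // -ltnS ltnNge.
  by apply: contraL kl => l3; rewrite -leqNgt (leq_add k3 l3).
case=> [A4|B4].
  have [//|X SX|X X' SX SX' e|M uM hM] := hit_few_lines _ _ _ A4.
  - by rewrite S2 ?freeS.
  - apply: span_eq_det; rewrite ?S2 ?freeS // => Z sZ.
    by rewrite (det_pluecker (S2 _ SX) sZ) (det_pluecker (S2 _ SX') sZ) e.
  have [ell [ellK ellU]] := adapted_lift uM; exists ell; split=> // X Y SX TY.
  apply: ellU; first exact: ST.
  have [i] := hM _ SX; case: X SX (S2 _ SX) => [|u [|v []]] // SX _.
  exact: (@adapted_hit _ ([:: u; v] ++ Y) i 0 1).
have [//|Y TY|Y Y' TY TY' e|M uM hM] := hit_few_lines _ _ _ B4.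
- by rewrite T2 ?freeT.
- apply: span_eq_det; rewrite ?T2 ?freeT // => Z sZ.
  rewrite !(det_swap_pairs _ sZ) ?T2 //.
  by rewrite (det_pluecker sZ (T2 _ TY)) (det_pluecker sZ (T2 _ TY')) e.
have [ell [ellK ellU]] := adapted_lift uM; exists ell; split=> // X Y SX TY.
apply: ellU; first exact: ST.
have [i] := hM _ TY; case: Y TY (T2 _ TY) => [|u [|v []]] // TY _.
case: X SX (S2 _ SX) => [|x [|y []]] // SX _.
exact: (@adapted_hit _ ([:: x; y] ++ [:: u; v]) i 2 3).
Qed.

(** * Families of vectors and triples of vectors *)

Lemma free_enum2 n (A : {set 'rV['F_2]_n}) :
  0 \notin A -> (#|A| <= 2)%N -> free (enum A).
Proof.
rewrite cardE -mem_enum; have := enum_uniq A.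
case: (enum A) => [|a [|b []]] //= ; rewrite ?nil_free //.
  by move=> _; rewrite inE free_cons span_nil memv0 nil_free andbT eq_sym.
rewrite !inE andbT => ab /norP[a0 b0] _.
rewrite !free_cons span_nil memv0 nil_free span_seq1 eq_sym b0 !andbT.
apply/negP=> /vlineP[k ak]; move: ab a0; rewrite ak eq_sym.
by case: (F2_cases k) => ->; rewrite ?scale0r ?scale1r ?eqxx.
Qed.

(** The equation of the hyperplane spanned by a triple [Y]: the cofactors along
    the first row do not involve that row, for which 0 is a placeholder. *)
Definition normal_vector (Y : seq 'rV['F_2]_4) : 'rV['F_2]_4 :=
  \row_j cofactor (rows (0 :: Y)) 0 j.

Lemma rows_mul_normal (a : 'rV['F_2]_4) (Y : seq 'rV['F_2]_4) :
  rows (a :: Y) *m (normal_vector Y)^T = \det (rows (a :: Y)) *: delta_mx 0 0.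
Proof.
have -> : (normal_vector Y)^T = col 0 (\adj (rows (a :: Y))).
  apply/colP=> j; rewrite !mxE /cofactor; congr (_ * \det _).
  by apply/matrixP=> k l; rewrite !mxE.
by rewrite colE mulmxA mul_mx_adj mul_scalar_mx.
Qed.

(** The vectors of the first family pair to 1 with the normal vectors of the
    second, so by [card_dual_affine] in dimension 4 one of these sets has at
    most two elements. If these are vectors, a basis containing them gives every
    facet a row with a single 1. If they are normal vectors, they can be
    completed to a system of coordinates; the coordinate belonging to a triple
    is 0 on the triple and 1 on each vector of the first family, which gives
    every facet a column with a single 1. *)
Lemma lift_point_triples (S T : seq 'rV['F_2]_4 -> Prop) :
  (exists X, S X) -> (exists Y, T Y) ->
  (forall X, S X -> size X = 1) ->
  (forall X Y, S X -> T Y -> rows (X ++ Y) \in unitmx) ->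
  simultaneous_lift S T.
Proof.
move=> [X0 SX0] [Y0 TY0] S1 ST.
pose A := [set a | `[< S [:: a] >]].
pose B := [set b | `[< exists2 Y, T Y & normal_vector Y = b >]].
have SE X : S X -> exists2 a, X = [:: a] & a \in A.
  move=> SX; case: X SX (S1 _ SX) => [|a []] // SX _.
  by exists a => //; rewrite inE; apply/asboolP.
have [a0 _ Aa0] := SE _ SX0.
have BY Y : T Y -> normal_vector Y \in B.
  by move=> TY; rewrite inE; apply/asboolP; exists Y.
have det1 a Y : a \in A -> T Y ->
    rows (a :: Y) *m (normal_vector Y)^T = delta_mx 0 0.
  rewrite inE => /asboolP Sa TY.
  rewrite rows_mul_normal (_ : \det _ = 1) ?scale1r //.
  by apply: F2_neq0; rewrite -unitfE -unitmxE; apply: (ST _ _ Sa TY).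
have dual : {in A & B, forall a b : 'rV_4, a *m b^T = 1%:M}.
  move=> a _ Aa /[1!inE] /asboolP[Y TY <-].
  have := congr1 (row 0) (det1 _ _ Aa TY); rewrite row_mul rowK /= => ->.
  by apply/matrixP=> i j; rewrite !ord1 !mxE.
have A0 : 0 \notin A.
  apply/negP=> /dual/(_ (BY _ TY0)); rewrite mul0mx => /matrixP/(_ 0 0).
  by rewrite !mxE.
have B0 : 0 \notin B.
  apply/negP=> /(dual _ _ Aa0); rewrite trmx0 mulmx0 => /matrixP/(_ 0 0).
  by rewrite !mxE.
have [k [l [kl Ak Bl]]] := card_dual_affine Aa0 (BY _ TY0) dual.
have {Ak Bl kl} : (#|A| <= 2)%N \/ (#|B| <= 2)%N.
  rewrite card_Fp // in Ak Bl.
  have [k2|k2] := ltnP k 2;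
    [left; apply: leq_trans Ak _ | right; apply: leq_trans Bl _].
    by rewrite (@leq_exp2l 2 k 1).
  rewrite (@leq_exp2l 2 l 1) // -ltnS ltnNge.
  by apply: contraL kl => l2; rewrite -leqNgt (leq_add k2 l2).
case=> [A2|B2].
  have [M uM hM] := free_row (free_enum2 A0 A2).
  have [ell [ellK ellU]] := adapted_lift uM; exists ell; split=> // X Y SX TY.
  apply: ellU; first exact: ST.
  have [a -> Aa] := SE _ SX; have [i ia] : exists i, row i M = a.
    by apply: hM; rewrite mem_enum.
  by apply: Or31; exists 0, i; rewrite row_mul rowK /= -ia row_invmx.
have [M uM hM] := free_row (free_enum2 B0 B2).
have uM' : invmx M^T \in unitmx by rewrite unitmx_inv unitmx_tr.
have [ell [ellK ellU]] := adapted_lift uM'; exists ell; split=> // X Y SX TY.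
apply: ellU; first exact: ST.
have [a -> Aa] := SE _ SX; have [j jY] : exists j, row j M = normal_vector Y.
  by apply: hM; rewrite mem_enum BY.
apply: Or33; exists 0, j; rewrite colE -mulmxA -colE invmxK -tr_row jY.
exact: det1.
Qed.

(** * Characteristic maps on a join *)

(** Along an enumeration [r] of [s], an expansion in the vectors is a product
    with their matrix. *)
Lemma is_basis_rows (A : comUnitRingType) (n : nat) (V : choiceType)
    (lam : V -> 'rV[A]_n) (s : {fset V}) (r : seq V) :
  uniq r -> r =i s -> size r = n ->
  is_basis (fun v : s => lam (val v)) <-> rows (map lam r) \in unitmx.
Proof.
move=> ur rs sr.
have ir (i : 'I_n) : (i < size r)%N by rewrite sr.
have mem_s (i : 'I_n) : tnth (in_tuple r) (cast_ord (esym sr) i) \in s.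
  by rewrite -rs mem_tnth.
pose h i : s := [` mem_s i]%fset.
have lt_r (v : s) : (index (val v) r < n)%N.
  by rewrite -[ltnRHS]sr index_mem rs fsvalP.
pose k (v : s) : 'I_n := Ordinal (lt_r v).
have kK : cancel k h.
  move=> v; apply: val_inj; rewrite /= (tnth_nth (val v)) /=.
  by rewrite nth_index // rs fsvalP.
have hK : cancel h k.
  move=> i; apply: val_inj; rewrite /= (tnth_nth (val (h i))) /=.
  by rewrite index_uniq ?ir.
have rowsE i : row i (rows (map lam r)) = lam (val (h i)).
  rewrite rowK (nth_map (val (h i))) ?ir //=.
  rewrite [RHS](congr1 lam (tnth_nth (val (h i)) _ _)).
  by congr lam.
have sumE (c : {ffun s -> A}) :
    \sum_v c v *: lam (val v) = (\row_i c (h i)) *m rows (map lam r).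
  rewrite mulmx_sum_row (reindex h) /=; last by exists k => ? _.
  by apply: eq_bigr => i _; rewrite rowsE mxE.
split=> [bas|unit_r x]; last first.
  exists [ffun v => (x *m invmx (rows (map lam r))) 0 (k v)]; split=> [|c].
    rewrite sumE -[LHS](mulmxKV unit_r); congr (_ *m _).
    by apply/rowP=> i; rewrite [RHS]mxE ffunE hK.
  rewrite sumE => ->; rewrite mulmxK //; apply/ffunP=> v.
  by rewrite ffunE mxE kK.
have /choice[c cP] : forall i, exists c : {ffun s -> A},
    delta_mx 0 i = \sum_v c v *: lam (val v).
  by move=> i; have [c [cE _]] := bas (delta_mx 0 i); exists c.
suff : (\matrix_i (\row_j c i (h j))) *m rows (map lam r) = 1%:M.
  by case/mulmx1_unit.
by apply/row_matrixP=> i; rewrite row_mul rowK -sumE -cP row1.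
Qed.

(** Coordinates in the basis define a bijection between [{ffun I -> A}] and
    ['rV[A]_n]. *)
Lemma card_is_basis (A : finComNzRingType) (n : nat) (I : finType)
    (b : I -> 'rV[A]_n) :
  is_basis b -> #|I| = n.
Proof.
move=> bas; have A1 : (1 < #|A|)%N by apply: card_finNzRing_gt1.
pose f (c : {ffun I -> A}) := \sum_i c i *: b i.
have /choice[g gK] : forall x, exists c, x = f c.
  by move=> x; have [c [cE _]] := bas x; exists c.
have fK : cancel f g.
  move=> c; have [c' [_ c'U]] := bas (f c).
  exact: etrans (esym (c'U _ (gK _))) (c'U _ erefl).
have := bij_eq_card (Bijective fK (fun x => esym (gK x))).
by rewrite card_ffun card_mx mul1n => /eqP; rewrite eqn_exp2l // => /eqP.
Qed.

Section JoinFacets.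
Variables (V W : choiceType) (K : complex V) (L : complex W).
Local Open Scope fset_scope.

Definition join_simplex (s1 : {fset V}) (s2 : {fset W}) : {fset V + W} :=
  (@inl V W) @` s1 `|` (@inr V W) @` s2.

Lemma inl_join_simplex s1 s2 v : (inl v \in join_simplex s1 s2) = (v \in s1).
Proof.
rewrite in_fsetU; apply/orP/idP=> [[] /imfsetP[x /= xs e]|vs].
- by case: e => ->.
- by [].
- by left; apply/imfsetP; exists v.
Qed.

Lemma inr_join_simplex s1 s2 w : (inr w \in join_simplex s1 s2) = (w \in s2).
Proof.
rewrite in_fsetU; apply/orP/idP=> [[] /imfsetP[x /= xs e]|ws].
- by [].
- by case: e => ->.
- by right; apply/imfsetP; exists w.
Qed.

Lemma join_simplex_sub s1 s2 t1 t2 :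
  (join_simplex s1 s2 `<=` join_simplex t1 t2) = (s1 `<=` t1) && (s2 `<=` t2).
Proof.
apply/fsubsetP/andP=> [st|[/fsubsetP st1 /fsubsetP st2]].
  by split; apply/fsubsetP=> x xs; [have := st (inl x) | have := st (inr x)];
    rewrite ?inl_join_simplex ?inr_join_simplex; apply.
by case=> x; rewrite ?inl_join_simplex ?inr_join_simplex;
  [apply: st1 | apply: st2].
Qed.

Lemma join_simplex_inj s1 s2 t1 t2 :
  join_simplex s1 s2 = join_simplex t1 t2 -> s1 = t1 /\ s2 = t2.
Proof.
move=> e; split; apply/fsetP=> x.
  by rewrite -(inl_join_simplex s1 s2) e inl_join_simplex.
by rewrite -(inr_join_simplex s1 s2) e inr_join_simplex.
Qed.

Lemma facet_join s : facet (join K L) s <->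
  exists s1 s2, [/\ facet K s1, facet L s2 & s = join_simplex s1 s2].
Proof.
split=> [[[s1 [s2 [K1 L2 ->]]] smax]|[s1 [s2 [[K1 max1] [L2 max2] ->]]]].
  rewrite -/(join_simplex s1 s2) in smax *.
  exists s1, s2; split=> //; split=> // t Kt st.
    have [] // : t = s1 /\ s2 = s2.
    apply: join_simplex_inj; apply: smax; first by exists t, s2.
    by rewrite join_simplex_sub st fsubset_refl.
  have [] // : s1 = s1 /\ t = s2.
  apply: join_simplex_inj; apply: smax; first by exists s1, t.
  by rewrite join_simplex_sub st fsubset_refl.
split; first by exists s1, s2.
move=> _ [t1 [t2 [Kt1 Lt2 ->]]].
rewrite -/(join_simplex t1 t2) join_simplex_sub.
by case/andP=> /(max1 _ Kt1) -> /(max2 _ Lt2) ->.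
Qed.

Lemma join_simplex_enum (s1 : {fset V}) (s2 : {fset W})
    (r := map (@inl V W) s1 ++ map (@inr V W) s2) :
  [/\ uniq r, r =i join_simplex s1 s2 & size r = (#|` s1| + #|` s2|)%N].
Proof.
split.
- rewrite cat_uniq !map_inj_uniq ?fset_uniq ?andbT //=; try by move=> ? ? [].
  by apply/hasPn => _ /mapP[w _ ->]; apply/mapP=> -[].
- move=> x; rewrite mem_cat in_fsetU; congr (_ || _); apply/mapP/imfsetP => /=.
  + by case=> y; exists y. + by case=> y; exists y.
  + by case=> y; exists y. + by case=> y; exists y.
- by rewrite size_cat !size_map.
Qed.

End JoinFacets.

(** The empty simplex is contained in every vertex. *)
Lemma facet_neq0 (V : choiceType) (K : complex V) s :
  inhabited V -> facet K s -> (0 < #|` s|)%N.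
Proof.
case=> v [_ max]; rewrite cardfs_gt0; apply/negP=> /eqP s0.
have := max [fset v]%fset (faces1 K v).
rewrite s0 => /(_ (fsub0set _)) /fsetP /(_ v).
by rewrite !inE eqxx.
Qed.

(** Both orders are needed because the families of [K] and [L] change roles
    when the facets of [L] are single vertices. *)
Lemma join_simplex_basis (A : comUnitRingType) (n : nat) (V W : choiceType)
    (lam : V + W -> 'rV[A]_n) (s1 : {fset V}) (s2 : {fset W})
    (X := [seq lam (inl v) | v <- s1]) (Y := [seq lam (inr w) | w <- s2]) :
  (#|` s1| + #|` s2|)%N = n ->
  (is_basis (fun v : join_simplex s1 s2 => lam (val v)) <->
     rows (X ++ Y) \in unitmx) /\
  (is_basis (fun v : join_simplex s1 s2 => lam (val v)) <->
     rows (Y ++ X) \in unitmx).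
Proof.
have [uniq_r mem_r <- size_r] := join_simplex_enum s1 s2.
have XE : X = map lam (map inl s1) by rewrite -map_comp.
have YE : Y = map lam (map inr s2) by rewrite -map_comp.
split; rewrite XE YE -map_cat; apply: is_basis_rows => //.
- by rewrite uniq_catC.
- by move=> x; rewrite -mem_r !mem_cat orbC.
- by rewrite size_cat addnC -size_cat.
Qed.

Theorem theorem4p3 (R : realType) (V W : choiceType)
    (K : complex V) (L : complex W)
    (hV : inhabited V) (hW : inhabited W)
    (hKL : simplicial_sphere R 3 (join K L)) :
  toric_lifting_property (join K L).
Proof.
move=> lamR char.
have facetP s1 s2 : facet K s1 -> facet L s2 ->
    facet (join K L) (join_simplex s1 s2).
  by move=> K1 L2; apply/facet_join; exists s1, s2.
have card4 s1 s2 : facet K s1 -> facet L s2 -> (#|` s1| + #|` s2|)%N = 4.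
  move=> K1 L2; have [u m <-] := join_simplex_enum s1 s2.
  rewrite (perm_size (uniq_perm u (fset_uniq _) m)) -[LHS]/#|` _| cardfE.
  exact: card_is_basis (char _ (facetP _ _ K1 L2)).
pose S X := exists2 s1, facet K s1 & X = [seq lamR (inl v) | v <- s1].
pose T Y := exists2 s2, facet L s2 & Y = [seq lamR (inr w) | w <- s2].
pose good (ell : 'rV['F_2]_4 -> 'rV[int]_4) :=
  (forall v, mod2 (ell v) = v) /\ forall s1 s2, facet K s1 -> facet L s2 ->
    is_basis (fun v : join_simplex s1 s2 => ell (lamR (val v))).
suff [ell [ellK ellB]] : exists ell, good ell.
  exists (ell \o lamR); split=> [s|v]; last exact: ellK.
  by case/facet_join=> s1 [s2 [K1 L2 ->]]; apply: ellB.
have STu X Y : S X -> T Y ->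
    rows (X ++ Y) \in unitmx /\ rows (Y ++ X) \in unitmx.
  move=> [s1 K1 ->] [s2 L2 ->].
  have [XY YX] := join_simplex_basis lamR (card4 _ _ K1 L2).
  by have /= bas := char _ (facetP _ _ K1 L2); split; [apply/XY | apply/YX].
have goodST : simultaneous_lift S T -> exists ell, good ell.
  case=> ell [ellK ellU]; exists ell; split=> // s1 s2 K1 L2.
  have [XY _] := join_simplex_basis (ell \o lamR) (card4 _ _ K1 L2).
  apply/XY; rewrite !(map_comp ell (fun v => lamR _)) -map_cat.
  by apply: ellU; [exists s1 | exists s2].
have goodTS : simultaneous_lift T S -> exists ell, good ell.
  case=> ell [ellK ellU]; exists ell; split=> // s1 s2 K1 L2.
  have [_ YX] := join_simplex_basis (ell \o lamR) (card4 _ _ K1 L2).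
  apply/YX; rewrite !(map_comp ell (fun v => lamR _)) -map_cat.
  by apply: ellU; [exists s2 | exists s1].
(* Without facets, every section of the reduction modulo 2 will do. *)
have [[s1 [s2 [K1 L2]]]|nofacet] :=
  pselect (exists s1 s2, facet K s1 /\ facet L s2); last first.
  exists (map_mx lift01); split=> [v|s1 s2 K1 L2]; first exact: lift01_mxK.
  by case: nofacet; exists s1, s2.
have exS : exists X, S X by eexists; exists s1.
have exT : exists Y, T Y by eexists; exists s2.
have sizeS X : S X -> size X = #|` s1|.
  move=> [t1 Kt1 ->]; rewrite size_map -[LHS]/#|` _|.
  by apply/(@addIn #|` s2|); rewrite !card4.
have sizeT Y : T Y -> size Y = #|` s2|.
  move=> [t2 Lt2 ->]; rewrite size_map -[LHS]/#|` _|.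
  by apply/(@addnI #|` s1|); rewrite !card4.
have := card4 _ _ K1 L2.
move: sizeS sizeT (facet_neq0 hV K1) (facet_neq0 hW L2).
case: #|` s1| => [|[|[|n]]] //;
  case: #|` s2| => [|[|[|m]]] // sizeS sizeT _ _ e //.
- by apply/goodST/lift_point_triples => // X Y SX /(STu _ _ SX)[].
- by apply/goodST/lift_pairs => // X Y SX /(STu _ _ SX)[].
- by apply/goodTS/lift_point_triples => // Y X TY /STu/(_ TY)[].
- by move: e; rewrite !addSn !addnS.
- by move: e; rewrite !addSn !addnS.
Qed.
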